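(* Let $\mathbb{F}$ be a field of characteristic $2$ with $|\mathbb{F}|>2$. Let $\Gamma$ be the reduct of the lift of $\widetilde H_3(\mathbb{F})$ with respect to $\ell^U$, let $N=S_2(W)/\langle U\rangle_{\mathbb{F}_2}$, and let $\mathrm{SL}_4(\mathbb{F})\ltimes N$ act on $\Gamma$ by $([v\otimes f],n)^{(g,k)}=([v^g\otimes f^g],n^g+k)$. Then the stabilizer $H$ in $\mathrm{SL}_4(\mathbb{F})\ltimes N$ of a connected component of $\Gamma$ is a non-split extension of $\mathrm{SL}_4(\mathbb{F})$ by (a normal subgroup isomorphic to) $\mathbb{F}^6$.
   Context: Groups act on the right. All graphs are simple and undirected; a dart is an ordered pair $(u,v)$ of adjacent vertices. For a voltage assignment $\ell:D(\Delta)\to N$ into an abelian group $N$ (written additively, with $\ell(v,u)=-\ell(u,v)$), the lift of $\Delta$ is the graph on $V(\Delta)\times N$ with $(u,m)\perp(v,n)$ iff $u\perp v$ and $\ell(u,v)=m-n$. The reduct $\Gamma'/\sim$ of a graph $\Gamma'$ identifies vertices with equal neighbourhoods; in the lift considered here, the class of $(v\otimes f,n)$ is written $([v\otimes f],n)$, where $[v\otimes f]$ is the class of $v\otimes f$ in $\widetilde H_3(\mathbb{F})$. Let $V=\mathbb{F}^4$, $V^*$ its dual, with $\mathrm{SL}_4(\mathbb{F})=\mathrm{SL}(V)$ acting naturally on $V$, $V^*$ and all tensor constructions. $\widetilde H_3(\mathbb{F})$ is the graph whose vertices are the tensors $v\otimes f\in V\otimes V^*$ with $f(v)\neq0$, with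 $v\otimes f\perp w\otimes g$ iff $f(w)=g(v)=0$. Let $W=\bigwedge^2V$. Fix an isomorphism $\chi:\bigwedge^4V\to\mathbb{F}$. Identify $\bigwedge^2V^*$ with $(\bigwedge^2V)^*$ via $(f_1\wedge f_2)(v_1\wedge v_2)=f_1(v_1)f_2(v_2)-f_1(v_2)f_2(v_1)$; let $\psi:\bigwedge^2V\to\bigwedge^2V^*$ be $\psi(\hat w)(\hat v)=\chi(\hat v\wedge\hat w)$ and $\phi=\psi^{-1}$. $S_2(W)$ is the symmetric square of $W$, with product written $ab$. $U=(w\wedge x)(y\wedge z)+(w\wedge y)(z\wedge x)+(w\wedge z)(x\wedge y)$ for any $w,x,y,z\in V$ with $\chi(w\wedge x\wedge y\wedge z)=1$ (independent of the choice and $\mathrm{SL}(V)$-invariant). $\ell$ assigns to the dart from $v_1\otimes h_1$ to $v_2\otimes h_2$ the element $h_1(v_1)^{-1}h_2(v_2)^{-1}(v_1\wedge v_2)\,\phi(h_1\wedge h_2)\in S_2(W)$, and $\ell^U$ is its composition with $S_2(W)\to S_2(W)/\langle U\rangle_{\mathbb{F}_2}$. *)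

(* Defs.v *)
From HB Require Import structures.
From mathcomp Require Import all_boot all_order all_algebra.
From mathcomp Require Import generic_quotient boolp.
From Stdlib Require Import Relations.Relation_Operators.

Set Implicit Arguments.
Unset Strict Implicit.
Unset Printing Implicit Defensive.

Import Order.TTheory GRing.Theory.
Local Open Scope ring_scope.
Local Open Scope quotient_scope.

Section Model.
Variable F : fieldType.

(* g acts on v by v *m g, and on f by invmx g *m f, so that f^g(v^g) = f(v). *)
Definition pairing (v : 'rV[F]_4) (f : 'cV[F]_4) : F := (v *m f) 0 0.

Definition tensor (v : 'rV[F]_4) (f : 'cV[F]_4) : 'M[F]_4 := f *m v.

Definition is_vtx (M : 'M[F]_4) : Prop :=
  exists (v : 'rV[F]_4) (f : 'cV[F]_4), M = tensor v f /\ pairing v f != 0.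

(* ---------- W = /\^2 V, basis e_i /\ e_j (i < j) ----------------------- *)
Definition wpairs : seq (nat * nat) :=
  [:: (0, 1); (0, 2); (0, 3); (1, 2); (1, 3); (2, 3)]%N.
Definition wi (k : 'I_6) : 'I_4 := inord (nth (0, 0)%N wpairs k).1.
Definition wj (k : 'I_6) : 'I_4 := inord (nth (0, 0)%N wpairs k).2.

Definition wedge (v w : 'rV[F]_4) : 'rV[F]_6 :=
  \row_k (v 0 (wi k) * w 0 (wj k) - v 0 (wj k) * w 0 (wi k)).

(* h1 /\ h2 in /\^2 V^* = (/\^2 V)^*, as the row of its values on the basis
   e_i /\ e_j :  (h1 /\ h2)(e_i /\ e_j) = h1(e_i)h2(e_j) - h1(e_j)h2(e_i) *)
Definition wedgeD (h1 h2 : 'cV[F]_4) : 'rV[F]_6 :=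
  \row_k (h1 (wi k) 0 * h2 (wj k) 0 - h1 (wj k) 0 * h2 (wi k) 0).

(* matrix of /\^2 g : (v g) /\ (w g) = (v /\ w) *m wedge2 g *)
Definition wedge2 (g : 'M[F]_4) : 'M[F]_6 :=
  \matrix_(k, l) (g (wi k) (wi l) * g (wj k) (wj l)
                  - g (wi k) (wj l) * g (wj k) (wi l)).

(* ---------- chi : /\^4 V -> F  (all isomorphisms are c * det, c <> 0) -- *)
Definition chi4 (c : F) (v1 v2 v3 v4 : 'rV[F]_4) : F :=
  c * \det (\matrix_(r < 4, j < 4) (nth 0 [:: v1; v2; v3; v4] r) 0 j).

Definition evec (i : 'I_4) : 'rV[F]_4 := delta_mx 0 i.

(* psi : W -> W^*,  psi(w)(v) = chi(v /\ w); as a matrix acting on rows: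
   psi(w) = w *m Psi, with Psi q p = chi(e_p /\ e_q)                      *)
Definition Psi (c : F) : 'M[F]_6 :=
  \matrix_(q, p) chi4 c (evec (wi p)) (evec (wj p)) (evec (wi q)) (evec (wj q)).

Definition phi (c : F) (y : 'rV[F]_6) : 'rV[F]_6 := y *m invmx (Psi c).

(* ---------- S_2(W) = (W (x) W) / < a(x)b - b(x)a > ---------------------- *)
(* W (x) W is modelled as 'M_6 (a (x) b = a^T *m b); the relations
   a(x)b - b(x)a span exactly { X - X^T }.                                *)
Definition sprod (a b : 'rV[F]_6) : 'M[F]_6 := a^T *m b.

Definition actS (g : 'M[F]_4) (s : 'M[F]_6) : 'M[F]_6 :=
  (wedge2 g)^T *m s *m wedge2 g.

Definition Urep (w x y z : 'rV[F]_4) : 'M[F]_6 :=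
  sprod (wedge w x) (wedge y z) + sprod (wedge w y) (wedge z x)
  + sprod (wedge w z) (wedge x y).

(* N = S_2(W) / <U>_{F_2} = (W (x) W) / ({X - X^T} + Z.U)  *)
Definition eNrel (Ur : 'M[F]_6) : rel 'M[F]_6 := fun s t =>
  `[< exists (n : int) (X : 'M[F]_6), s - t = Ur *~ n + (X - X^T) >].

Lemma eNrel_refl Ur : reflexive (eNrel Ur).
Proof.
move=> s; apply/asboolP; exists 0%R, 0.
by rewrite subrr mulr0z trmx0 subrr addr0.
Qed.

Lemma eNrel_sym Ur : symmetric (eNrel Ur).
Proof.
have H s t : eNrel Ur s t -> eNrel Ur t s.
  move=> /asboolP [n [X e]]; apply/asboolP; exists (- n)%R, (- X).
  rewrite -opprB e mulrNz linearN /= opprD; congr (_ + _).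
  by rewrite opprB opprK addrC.
by move=> s t; apply/idP/idP => /H.
Qed.

Lemma eNrel_trans Ur : transitive (eNrel Ur).
Proof.
move=> t s u /asboolP [n [X e1]] /asboolP [m [Y e2]]; apply/asboolP.
exists (n + m)%R, (X + Y).
have -> : s - u = (s - t) + (t - u) by rewrite addrA subrK.
rewrite e1 e2 mulrzDr linearD /= opprD.
set A := Ur *~ n; set B := Ur *~ m.
set P := X^T; set Q := Y^T.
rewrite -!addrA; congr (_ + _).
rewrite [RHS]addrC -!addrA; congr (_ + _).
rewrite [RHS]addrC -!addrA; congr (_ + _).
by rewrite [LHS]addrA [LHS]addrC.
Qed.

Definition eN (Ur : 'M[F]_6) : equiv_rel 'M[F]_6 :=
  EquivRel (eNrel Ur) (@eNrel_refl Ur) (@eNrel_sym Ur) (@eNrel_trans Ur).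

Definition NQ (Ur : 'M[F]_6) := {eq_quot (eN Ur)}.

Section Group.
Variable Ur : 'M[F]_6.
Local Notation N := (NQ Ur).

Definition piN (s : 'M[F]_6) : N := \pi_N s.
Definition zeroN : N := piN 0.
Definition addN (a b : N) : N := piN (repr a + repr b).
Definition oppN (a : N) : N := piN (- repr a).
Definition subN (a b : N) : N := piN (repr a - repr b).
Definition actN (g : 'M[F]_4) (a : N) : N := piN (actS g (repr a)).

(* SL_4(F) |x N : carrier 'M_4 * N restricted to det = 1;
   (g,k)(g',k') = (g g', k^{g'} + k')  (right actions)                    *)
Definition inG (a : 'M[F]_4 * N) : Prop := \det a.1 = 1.
Definition mulG (a b : 'M[F]_4 * N) : 'M[F]_4 * N :=
  (a.1 *m b.1, addN (actN b.1 a.2) b.2).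
Definition oneG : 'M[F]_4 * N := (1%:M, zeroN).
Definition invG (a : 'M[F]_4 * N) : 'M[F]_4 * N :=
  (invmx a.1, oppN (actN (invmx a.1) a.2)).

Definition ell (c : F) (v1 : 'rV[F]_4) (h1 : 'cV[F]_4)
    (v2 : 'rV[F]_4) (h2 : 'cV[F]_4) : 'M[F]_6 :=
  ((pairing v1 h1)^-1 * (pairing v2 h2)^-1) *:
     sprod (wedge v1 v2) (phi c (wedgeD h1 h2)).

Definition ellU c v1 h1 v2 h2 : N := piN (ell c v1 h1 v2 h2).

Definition isLV (x : 'M[F]_4 * N) : Prop := is_vtx x.1.

Definition liftadj (c : F) (x y : 'M[F]_4 * N) : Prop :=
  isLV x /\ isLV y /\
  exists (v : 'rV[F]_4) (f : 'cV[F]_4) (w : 'rV[F]_4) (g : 'cV[F]_4),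
    x.1 = tensor v f /\ y.1 = tensor w g /\
    pairing v f != 0 /\ pairing w g != 0 /\
    pairing w f = 0 /\ pairing v g = 0 /\
    ellU c v f w g = subN x.2 y.2.

(* equal neighbourhoods (the relation defining the reduct) *)
Definition sameNbr (c : F) (x y : 'M[F]_4 * N) : Prop :=
  isLV x /\ isLV y /\ forall z, isLV z -> (liftadj c x z <-> liftadj c y z).

(* y (a lift vertex) lies, via its class, in the connected component of
   the reduct Gamma containing the class of x *)
Definition gstep (c : F) (x y : 'M[F]_4 * N) : Prop :=
  liftadj c x y \/ sameNbr c x y.
Definition compG (c : F) (x y : 'M[F]_4 * N) : Prop :=
  clos_refl_trans _ (gstep c) x y.

(* the action ( [v(x)f], n )^(g,k) = ( [v^g (x) f^g], n^g + k ),
   on representatives: v^g (x) f^g = invmx g *m (f *m v) *m g            *)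
Definition actLV (a : 'M[F]_4 * N) (x : 'M[F]_4 * N) : 'M[F]_4 * N :=
  (invmx a.1 *m x.1 *m a.1, addN (actN a.1 x.2) a.2).

Definition stabComp (c : F) (x0 : 'M[F]_4 * N) (a : 'M[F]_4 * N) : Prop :=
  inG a /\
  forall y, isLV y -> (compG c x0 y <-> compG c x0 (actLV a y)).

Definition subgroupG (S : 'M[F]_4 * N -> Prop) : Prop :=
  [/\ S oneG, (forall a b, S a -> S b -> S (mulG a b))
    & (forall a, S a -> S (invG a))].

Definition nonsplit_ext_SL4_by_F6 (H : 'M[F]_4 * N -> Prop) : Prop :=
  exists K : 'M[F]_4 * N -> Prop,
  [/\ (forall k, K k -> H k),
      (forall h k, H h -> K k -> K (mulG (invG h) (mulG k h))),
      (exists iota : 'rV[F]_6 -> 'M[F]_4 * N,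
         [/\ injective iota,
             (forall y, K y <-> exists u, y = iota u) &
             (forall u u', iota (u + u') = mulG (iota u) (iota u'))]),
      (exists pi : 'M[F]_4 * N -> 'M[F]_4,
         [/\ (forall h, H h -> \det (pi h) = 1),
             (forall h h', H h -> H h' -> pi (mulG h h') = pi h *m pi h'),
             (forall s : 'M[F]_4, \det s = 1 -> exists h, H h /\ pi h = s) &
             (forall h, H h -> (pi h = 1%:M <-> K h))]) &
      ~ (exists C : 'M[F]_4 * N -> Prop,
           [/\ (forall h, C h -> H h), subgroupG C,
               (forall h, C h -> K h -> h = oneG) &
               (forall h, H h -> exists a b, [/\ C a, K b & h = mulG a b])])].

End Group.
End Model.

(* Main.v *)
Require Import Defs.
From HB Require Import structures.
From mathcomp Require Import all_boot all_order all_algebra.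
From mathcomp Require Import generic_quotient boolp.
From mathcomp Require Import ssrAC ring.
From Stdlib Require Import Relations.Relation_Operators.
Import GRing.Theory.
Local Open Scope ring_scope.

(** Write s for an element of S_2(W), Psi for the Gram matrix of chi on W.  In
characteristic 2 the polarization s + s^T kills exactly the squares of W, and
Psi (s + s^T) is an endomorphism of W, equal to 1 when s = U.  For a vertex
v (x) f let M be the rank one idempotent f v / f(v).  The voltage of a dart from
M1 to M2 polarizes to 1 + /\^2(1 + M1) + /\^2(1 + M2): modulo F_2 it is a
coboundary, so (M, n) |-> Psi (n + n^T) + /\^2(1 + M), read modulo F_2, is
constant on components.  Conversely any two vertices have a common neighbour, and
suitable quadrangles have voltage a (e_i /\ e_j)^2 with a arbitrary, so this
potential separates components.  Hence the stabilizer meets N in the squares of W,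
a copy of F^6, and maps onto SL_4.

If it split, the transvections 1 + a E_02 and 1 + b E_13, which commute, would lift
to commuting elements for all a and b.  At the base vertex e_0 (x) e_0^*, comparing
coefficients of (e_2 /\ e_3)^2 gives a b / c = b^2 P(a) + a^2 Q(b) for some functions
P and Q; the instances a, b in {1, e} force e^2 (e - 1)^2 = 0. *)

Set Implicit Arguments.
Unset Strict Implicit.
Unset Printing Implicit Defensive.

(** * Index bookkeeping for F^4 and its exterior square *)

Section Coordinates.
Variable R : nmodType.

Lemma sum_inord4 (G : 'I_4 -> R) :
  \sum_i G i = G (inord 0) + G (inord 1) + G (inord 2) + G (inord 3).
Proof.
rewrite !big_ord_recr big_ord0 /= add0r.
by congr (_ + _ + _ + _); congr G; apply: val_inj; rewrite /= inordK.
Qed.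

Lemma sum_inord6 (G : 'I_6 -> R) :
  \sum_i G i = G (inord 0) + G (inord 1) + G (inord 2) + G (inord 3)
             + G (inord 4) + G (inord 5).
Proof.
rewrite !big_ord_recr big_ord0 /= add0r.
by congr (_ + _ + _ + _ + _ + _); congr G; apply: val_inj; rewrite /= inordK.
Qed.

End Coordinates.

Lemma inord4_eq (i j : nat) : (i < 4)%N -> (j < 4)%N ->
  ((inord i : 'I_4) == inord j) = (i == j).
Proof. by move=> hi hj; rewrite -val_eqE /= !inordK. Qed.

Lemma inord6_eq (i j : nat) : (i < 6)%N -> (j < 6)%N ->
  ((inord i : 'I_6) == inord j) = (i == j).
Proof. by move=> hi hj; rewrite -val_eqE /= !inordK. Qed.

Lemma wi_inord (k : nat) : (k < 6)%N ->
  wi (inord k) = inord (nth (0, 0)%N wpairs k).1.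
Proof. by move=> hk; rewrite /wi inordK. Qed.

Lemma wj_inord (k : nat) : (k < 6)%N ->
  wj (inord k) = inord (nth (0, 0)%N wpairs k).2.
Proof. by move=> hk; rewrite /wj inordK. Qed.

Definition wedge_indexE := (wi_inord, wj_inord).

Lemma ord6_ind (P : 'I_6 -> Prop) :
  P (inord 0) -> P (inord 1) -> P (inord 2) -> P (inord 3) -> P (inord 4) ->
  P (inord 5) -> forall k, P k.
Proof.
move=> p0 p1 p2 p3 p4 p5 k; rewrite -[k]inord_val.
by case: k => [[|[|[|[|[|[|//]]]]]] hk].
Qed.

(** * The exterior square of F^4 and the Klein form *)

Section Wedge.
Variable F : fieldType.
Implicit Types (v w x y z : 'rV[F]_4) (f g h : 'cV[F]_4) (A B : 'M[F]_4).

Lemma pairingE v f : pairing v f =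
  v 0 (inord 0) * f (inord 0) 0 + v 0 (inord 1) * f (inord 1) 0
  + v 0 (inord 2) * f (inord 2) 0 + v 0 (inord 3) * f (inord 3) 0.
Proof. by rewrite /pairing mxE sum_inord4. Qed.

Local Notation ent M i j := (M (inord i%N) (inord j%N)).

(** Laplace expansion along the first two rows rather than along one, so that every factor is a
    coordinate of a [wedge]. *)
Lemma det4E (M : 'M[F]_4) :
  \det M =
    (ent M 0 0 * ent M 1 1 - ent M 0 1 * ent M 1 0)
      * (ent M 2 2 * ent M 3 3 - ent M 2 3 * ent M 3 2)
  - (ent M 0 0 * ent M 1 2 - ent M 0 2 * ent M 1 0)
      * (ent M 2 1 * ent M 3 3 - ent M 2 3 * ent M 3 1)
  + (ent M 0 0 * ent M 1 3 - ent M 0 3 * ent M 1 0)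
      * (ent M 2 1 * ent M 3 2 - ent M 2 2 * ent M 3 1)
  + (ent M 0 1 * ent M 1 2 - ent M 0 2 * ent M 1 1)
      * (ent M 2 0 * ent M 3 3 - ent M 2 3 * ent M 3 0)
  - (ent M 0 1 * ent M 1 3 - ent M 0 3 * ent M 1 1)
      * (ent M 2 0 * ent M 3 2 - ent M 2 2 * ent M 3 0)
  + (ent M 0 2 * ent M 1 3 - ent M 0 3 * ent M 1 2)
      * (ent M 2 0 * ent M 3 1 - ent M 2 1 * ent M 3 0).
Proof.
have d2 (A : 'M[F]_2) : \det A = A ord0 ord0 * A (lift ord0 ord0) (lift ord0 ord0)
    - A ord0 (lift ord0 ord0) * A (lift ord0 ord0) ord0.
  rewrite (expand_det_row _ ord0) !big_ord_recl big_ord0 /= /cofactor !det_mx11.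
  rewrite !mxE /= expr0 expr1 mul1r addr0 mulN1r mulrN.
  by congr (_ * A _ _ - _ * A _ _); apply: val_inj.
have d3 (A : 'M[F]_3) i0 : \det A = \sum_j A i0 j * cofactor A i0 j.
  exact: expand_det_row.
pose m i j := ent M i j.
have mE (i j : 'I_4) : M i j = m i j by rewrite /m !inord_val.
rewrite (expand_det_row _ ord0) !big_ord_recl big_ord0 /= /cofactor.
rewrite !(d3 _ ord0) !big_ord_recl !big_ord0 /= /cofactor !d2.
rewrite !mxE !mE /= /bump /= !add1n /m !inord_val !add0n.
ring.
Qed.

Lemma chi4E (c : F) v w x y : chi4 c v w x y = c * (
    (v 0 (inord 0) * w 0 (inord 1) - v 0 (inord 1) * w 0 (inord 0))
      * (x 0 (inord 2) * y 0 (inord 3) - x 0 (inord 3) * y 0 (inord 2))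
  - (v 0 (inord 0) * w 0 (inord 2) - v 0 (inord 2) * w 0 (inord 0))
      * (x 0 (inord 1) * y 0 (inord 3) - x 0 (inord 3) * y 0 (inord 1))
  + (v 0 (inord 0) * w 0 (inord 3) - v 0 (inord 3) * w 0 (inord 0))
      * (x 0 (inord 1) * y 0 (inord 2) - x 0 (inord 2) * y 0 (inord 1))
  + (v 0 (inord 1) * w 0 (inord 2) - v 0 (inord 2) * w 0 (inord 1))
      * (x 0 (inord 0) * y 0 (inord 3) - x 0 (inord 3) * y 0 (inord 0))
  - (v 0 (inord 1) * w 0 (inord 3) - v 0 (inord 3) * w 0 (inord 1))
      * (x 0 (inord 0) * y 0 (inord 2) - x 0 (inord 2) * y 0 (inord 0))
  + (v 0 (inord 2) * w 0 (inord 3) - v 0 (inord 3) * w 0 (inord 2))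
      * (x 0 (inord 0) * y 0 (inord 1) - x 0 (inord 1) * y 0 (inord 0))).
Proof. by rewrite /chi4 det4E !mxE !inordK. Qed.

Lemma chi4M (c : F) A v w x y :
  chi4 c (v *m A) (w *m A) (x *m A) (y *m A) = \det A * chi4 c v w x y.
Proof.
rewrite /chi4 mulrCA; congr (_ * _); rewrite mulrC -det_mulmx; congr (\det _).
apply/matrixP=> r j; rewrite !mxE.
transitivity (((nth 0 [:: v; w; x; y] r) *m A) 0 j).
  by case: r => [[|[|[|[|//]]]]] ?.
by rewrite mxE; apply: eq_bigr => k _; rewrite !mxE.
Qed.

(* In the order of [wpairs], the pair complementary to the [k]-th is the
   [5 - k]-th; only {0,2} and {1,3} give an odd permutation. *)
Definition klein : 'M[F]_6 :=
  \matrix_(q, p) if (q + p == 5)%N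
    then (-1) ^+ ((q == 1 :> nat) || (q == 4 :> nat)) else 0.

Lemma wedge_klein v w x y : (wedge v w *m klein *m (wedge x y)^T) 0 0 = chi4 1 v w x y.
Proof.
rewrite chi4E !mxE sum_inord6 !mxE !sum_inord6 !mxE !wedge_indexE //= !inordK //=; ring.
Qed.

Lemma wedge_evec k : wedge (evec F (wi k)) (evec F (wj k)) = delta_mx 0 k.
Proof.
apply/rowP=> l; rewrite !mxE !eqxx !(eq_sym l) /=; elim/ord6_ind: k; elim/ord6_ind: l.
all: by rewrite !wedge_indexE //= !inord4_eq // inord6_eq //=; ring.
Qed.

Lemma klein_row k l : klein k l =
  chi4 1 (evec F (wi k)) (evec F (wj k)) (evec F (wi l)) (evec F (wj l)).
Proof.
rewrite -wedge_klein !wedge_evec -rowE [RHS]mxE (bigD1 l) //= !mxE !eqxx mulr1.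
rewrite big1 ?addr0 //.
by move=> m /negPf ml; rewrite !mxE ml mulr0.
Qed.

Lemma klein_tr : klein^T = klein.
Proof. by apply/matrixP; elim/ord6_ind; elim/ord6_ind; rewrite !mxE !inordK. Qed.

Lemma Psi_klein (c : F) : Psi c = c *: klein.
Proof.
apply/matrixP=> q p; rewrite [LHS]mxE [RHS]mxE -klein_tr [klein^T _ _]mxE.
by rewrite klein_row /chi4 mul1r.
Qed.

Lemma klein_invol : klein *m klein = 1%:M.
Proof.
apply/matrixP; elim/ord6_ind; elim/ord6_ind;
  rewrite !mxE sum_inord6 !mxE !inordK //= inord6_eq //=; ring.
Qed.

Lemma Psi_mulV (c : F) : c != 0 -> Psi c *m (c^-1 *: klein) = 1%:M.
Proof.
move=> c0; rewrite Psi_klein -scalemxAl -scalemxAr klein_invol scalerA.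
by rewrite divff ?scale1r.
Qed.

Lemma invmx_Psi (c : F) : c != 0 -> invmx (Psi c) = c^-1 *: klein.
Proof.
move=> c0; have PV := Psi_mulV c0; have [U _] := mulmx1_unit PV.
by rewrite -[LHS]mulmx1 -PV mulKmx.
Qed.

Lemma wedgeM A v w : wedge (v *m A) (w *m A) = wedge v w *m wedge2 A.
Proof.
apply/rowP=> k; rewrite !mxE sum_inord6 !mxE !sum_inord4 !wedge_indexE //=; ring.
Qed.

Lemma wedge2M A B : wedge2 (A *m B) = wedge2 A *m wedge2 B.
Proof.
apply/matrixP=> k l; rewrite !mxE sum_inord6 !mxE !sum_inord4 !wedge_indexE //=; ring.
Qed.

Lemma wedge2_1 : wedge2 (1%:M : 'M[F]_4) = 1%:M.
Proof.
apply/matrixP; elim/ord6_ind; elim/ord6_ind;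
  rewrite !mxE !wedge_indexE //= !inord4_eq // !inord6_eq //=; ring.
Qed.

Lemma wedge2_row A k : row k (wedge2 A) = wedge (row (wi k) A) (row (wj k) A).
Proof. by apply/rowP=> l; rewrite !mxE. Qed.

(** The (k, l) entry is [chi4] of four rows of A, images of unit vectors, so [chi4M] takes out the
    determinant. Elements of SL_4 are therefore isometries of the Klein form. *)
Lemma wedge2_klein A :
  wedge2 A *m klein *m (wedge2 A)^T = \det A *: klein.
Proof.
apply/matrixP=> k l; rewrite [RHS]mxE klein_row -chi4M -!rowE.
rewrite -wedge_klein -!wedge2_row mxE [RHS]mxE; apply: eq_bigr => m _.
by rewrite !mxE; congr (_ * _); apply: eq_bigr => n _; rewrite !mxE.
Qed.

Lemma outerE (a b : 'rV[F]_6) k l : (a^T *m b) k l = a 0 k * b 0 l.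
Proof. by rewrite mxE big_ord1 mxE. Qed.

Lemma mul_kleinE (a : 'rV[F]_6) (k : nat) : (k < 6)%N ->
  (a *m klein) 0 (inord k) =
  (-1) ^+ ((k == 1) || (k == 4))%N * a 0 (inord (5 - k)).
Proof.
by case: k => [|[|[|[|[|[|//]]]]]] _; rewrite mxE sum_inord6 !mxE !inordK //=; ring.
Qed.

Lemma wedge2_add1E (f : 'cV[F]_4) v k l : (wedge2 (1%:M + f *m v) - 1%:M) k l =
  ((wi k == wi l)%:R + f (wi k) 0 * v 0 (wi l))
    * ((wj k == wj l)%:R + f (wj k) 0 * v 0 (wj l))
  - ((wi k == wj l)%:R + f (wi k) 0 * v 0 (wj l))
    * ((wj k == wi l)%:R + f (wj k) 0 * v 0 (wi l)) - (k == l)%:R.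
Proof. by rewrite !mxE !big_ord1. Qed.

(* The row action of [y^T *m (wedge v w)] on /\^2 V; in odd characteristic the
   left side is skew for the Klein form, which is what fixes the signs. *)
Lemma wedge_derivation v w f g :
  (wedgeD f g)^T *m wedge v w
    - (wedge v w *m klein)^T *m (wedgeD f g *m klein) =
  pairing w g *: (wedge2 (1%:M + f *m v) - 1%:M)
  + pairing v f *: (wedge2 (1%:M + g *m w) - 1%:M)
  - pairing v g *: (wedge2 (1%:M + f *m w) - 1%:M)
  - pairing w f *: (wedge2 (1%:M + g *m v) - 1%:M)
  - (pairing v f * pairing w g - pairing v g * pairing w f)%:M.
Proof.
(* Entrywise, so that [mxE] does not unfold the abbreviated matrices. *)
have E (A B C D G H : 'M[F]_6) (a b c d e : F) k l : (A - B) k l =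
  a * C k l + b * D k l - c * G k l - d * H k l - (e *+ (k == l)) ->
  (A - B) k l = (a *: C + b *: D - c *: G - d *: H - e%:M) k l.
  by move=> ->; rewrite !mxE.
apply/matrixP; elim/ord6_ind; elim/ord6_ind; apply: E;
  rewrite !wedge2_add1E [LHS]mxE [X in _ + X]mxE !outerE;
  rewrite !mul_kleinE //= !mxE !wedge_indexE //= !inord4_eq //= !inord6_eq //=;
  rewrite !pairingE; ring.
Qed.

(** The three-term Plücker relation for the coordinates [wi k] and [wj k] of the four vectors: U has
    no square term. *)
Lemma Urep_diag v w x y k : Urep v w x y k k = 0.
Proof. rewrite !mxE !big_ord1 !mxE; ring. Qed.

(** Since [klein] is its own inverse, this is what makes [Psi] times the polarization of U the
    identity. *)
Lemma Urep_tr v w x y : Urep v w x y + (Urep v w x y)^T = chi4 1 v w x y *: klein.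
Proof.
apply/matrixP; elim/ord6_ind; elim/ord6_ind;
  rewrite chi4E !mxE !big_ord1 !mxE !wedge_indexE //= ?inordK //=; ring.
Qed.

Lemma UrepM A v w x y :
  Urep (v *m A) (w *m A) (x *m A) (y *m A) = actS A (Urep v w x y).
Proof.
rewrite /Urep /actS /sprod !wedgeM !trmx_mul !mulmxDr !mulmxDl !mulmxA //.
Qed.

End Wedge.

Local Open Scope quotient_scope.

(** * Matrices in characteristic 2: polarization and congruence modulo the identity *)

Section CharTwo.
Variables (F : fieldType) (char2 : (2%:R : F) = 0).

Lemma addmx_char2 m n (A : 'M[F]_(m, n)) : A + A = 0.
Proof. by rewrite -mulr2n -scaler_nat char2 scale0r. Qed.

Lemma oppmx_char2 m n (A : 'M[F]_(m, n)) : - A = A.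
Proof. exact: addr0_eq (addmx_char2 A). Qed.

Lemma addr_char2 (a : F) : a + a = 0.
Proof. by rewrite -mulr2n -mulr_natl char2 mul0r. Qed.

Lemma oppr_char2 (a : F) : - a = a.
Proof. exact: addr0_eq (addr_char2 a). Qed.

(** Turns the integer multiples of U allowed in [eNrel] into the F_2-line of U. *)
Lemma mulmz_odd n (A : 'M[F]_n) (k : int) : A *~ k = A *+ odd `|k|%N.
Proof.
have E (m : nat) : A *+ m = A *+ odd m.
  rewrite -[in LHS](odd_double_half m) mulrnDr -mul2n mulrnA mulr2n.
  by rewrite addmx_char2 mul0rn addr0.
case: k => m; first exact: E.
by rewrite NegzE mulrNz oppmx_char2 abszN; exact: E.
Qed.

Definition polar n (s : 'M[F]_n) : 'M[F]_n := s + s^T.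

Lemma polarD n (s t : 'M[F]_n) : polar (s + t) = polar s + polar t.
Proof. by rewrite /polar linearD addrACA. Qed.

Lemma polar_alt n (X : 'M[F]_n) : polar (X - X^T) = 0.
Proof. by rewrite /polar linearB /= trmxK subrKA subrr. Qed.

Lemma polar_diag n (d : 'rV[F]_n) : polar (diag_mx d) = 0.
Proof. by rewrite /polar tr_diag_mx addmx_char2. Qed.

Lemma polar_conj n (G s : 'M[F]_n) : polar (G^T *m s *m G) = G^T *m polar s *m G.
Proof. by rewrite /polar !trmx_mul trmxK mulmxDr mulmxDl !mulmxA. Qed.

(** Such an s is symmetric, as signs do not matter, and X can be taken to be its strict upper
    triangle. In S_2(W) only the diagonal, a combination of squares, survives. *)
Lemma polar_eq0_split n (s : 'M[F]_n) : polar s = 0 ->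
  exists X, s = diag_mx (\row_i s i i) + (X - X^T).
Proof.
move=> s0; have sT i j : s j i = s i j.
  by have /matrixP/(_ i j) := s0; rewrite !mxE => /eqP; rewrite addr_eq0 oppr_char2 => /eqP.
exists (\matrix_(i, j) if (i < j)%N then s i j else 0).
apply/matrixP=> i j; rewrite !mxE oppr_char2 -val_eqE /=.
by case: ltngtP => [||/val_inj->]; rewrite ?(add0r, addr0, mulr0n, mulr1n) // sT.
Qed.

(* Congruence modulo the F_2-line of the identity, which is where [s |-> Psi (s + s^T)]
   sends the line of U. *)
Definition mod1 n (X Y : 'M[F]_n) : Prop := X = Y \/ X = Y + 1%:M.

Lemma mod1_sym n (X Y : 'M[F]_n) : mod1 X Y -> mod1 Y X.
Proof. by case=> ->; [left | right; rewrite -addrA addmx_char2 addr0]. Qed.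

Lemma mod1_trans n (Y X Z : 'M[F]_n) : mod1 X Y -> mod1 Y Z -> mod1 X Z.
Proof.
case=> -> [] ->; rewrite -?addrA ?addmx_char2 ?addr0; [by left|by right|by right|by left].
Qed.

Lemma mod1D n (X Y Z : 'M[F]_n) : mod1 X Y -> mod1 (X + Z) (Y + Z).
Proof. by case=> ->; [left | right; rewrite addrAC]. Qed.

Lemma mod1_cross n (A B X Y : 'M[F]_n) :
  mod1 (A + B + 1%:M) (X + Y) -> mod1 (X + A) (Y + B).
Proof.
move=> /(mod1D (Y + A)).
have -> : A + B + 1%:M + (Y + A) = Y + B + 1%:M.
  by rewrite (AC (3*2) (((4*2)*3)*(1*5))) /= addmx_char2 addr0.
have -> : X + Y + (Y + A) = X + A by rewrite (AC (2*2) ((1*4)*(2*3))) /= addmx_char2 addr0.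
by move=> H; apply: mod1_trans (mod1_sym H) _; right.
Qed.

Lemma mod1_conj n (G X Y : 'M[F]_n) : G \in unitmx ->
  mod1 X Y -> mod1 (invmx G *m X *m G) (invmx G *m Y *m G).
Proof.
move=> uG [] ->; [by left | right].
by rewrite mulmxDr mulmxDl mulmx1 mulVmx.
Qed.

Lemma mod1_conjE n (G X Y : 'M[F]_n) : G \in unitmx ->
  mod1 (invmx G *m X *m G) (invmx G *m Y *m G) -> mod1 X Y.
Proof.
move=> uG; have uV : invmx G \in unitmx by rewrite unitmx_inv.
by move=> /(mod1_conj uV); rewrite invmxK !mulmxA mulmxV // !mul1mx !mulmxK.
Qed.

(** * The group N and the action of SL_4 on it *)

Section Quotient.
Variables (c : F) (c0 : c != 0) (u1 u2 u3 u4 : 'rV[F]_4).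
Hypothesis hU : chi4 c u1 u2 u3 u4 = 1.
Local Notation Ur := (Urep u1 u2 u3 u4).
Local Notation N := (NQ Ur).

Lemma polar_U : polar Ur = c^-1 *: klein F.
Proof.
rewrite /polar Urep_tr; congr (_ *: _).
by move: hU; rewrite /chi4 mul1r => /(canRL (mulKf c0)) ->; rewrite mulr1.
Qed.

Lemma Psi_polar_U : Psi c *m polar Ur = 1%:M.
Proof. by rewrite polar_U Psi_mulV. Qed.

Lemma Psi_inj : injective (mulmx (Psi c) : 'M[F]_6 -> 'M[F]_6).
Proof.
apply: (can_inj (g := mulmx (invmx (Psi c)))) => X.
by rewrite mulKmx //; case: (mulmx1_unit (Psi_mulV c0)).
Qed.

(** A complete invariant of a class in N. Adding X - X^T or U leaves the diagonal alone, and U adds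
    the identity to the second component. Conversely, once polarizations agree up to U, the
    difference is diagonal plus X - X^T, and the equal diagonals kill its diagonal part. *)
Lemma piN_eqP (s t : 'M[F]_6) : piN Ur s = piN Ur t <->
  (forall k, s k k = t k k) /\ mod1 (Psi c *m polar s) (Psi c *m polar t).
Proof.
split=> [/eqquotP /asboolP [n [X]] | [dst pst]].
  rewrite mulmz_odd => /(canRL (subrK _)) ->; split=> [k|].
    have EX : (X - X^T) k k = 0 by rewrite !mxE subrr.
    have EU : (Ur *+ odd `|n|) k k = 0.
      by case: odd; rewrite ?mulr1n ?mulr0n ?Urep_diag ?mxE.
    by rewrite [LHS]mxE [X in X + _]mxE EU EX !add0r.
  rewrite 2!polarD polar_alt addr0; case: odd; rewrite ?mulr1n ?mulr0n.
    by right; rewrite [LHS]mulmxDr Psi_polar_U addrC.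
  by left; rewrite /polar trmx0 !add0r.
apply/eqquotP/asboolP.
have [e ep] : exists e : bool, polar (s - t - Ur *+ e) = 0.
  case: pst => [|e]; [move/Psi_inj => e | have {}e : polar s = polar t + polar Ur].
  - by exists false; rewrite subr0 polarD e /polar linearN addrACA !subrr addr0.
  - by apply: Psi_inj; rewrite [RHS]mulmxDr Psi_polar_U.
    by exists true; rewrite mulr1n !oppmx_char2 2!polarD e -addrA addmx_char2.
have [X eX] := polar_eq0_split ep.
have d0 : diag_mx (\row_i (s - t - Ur *+ e) i i) = 0.
  apply/matrixP=> i j; rewrite [LHS]mxE [X in X *+ _]mxE [RHS]mxE.
  have EU : (Ur *+ e) i i = 0.
    by case: (e); rewrite ?mulr1n ?mulr0n ?Urep_diag ?mxE.
  rewrite [X in X *+ _]mxE [(- (Ur *+ e)) i i]mxE EU !mxE dst.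
  by rewrite subrr oppr0 addr0 mul0rn.
by exists e%:Z, X; rewrite -pmulrn -[LHS](subrK (Ur *+ e)) eX d0 add0r addrC.
Qed.

Lemma piN_repr (a : N) : piN Ur (repr a) = a.
Proof. exact: reprK. Qed.

Lemma repr_piN (s : 'M[F]_6) : let r := repr (piN Ur s) in
  (forall k, r k k = s k k) /\ mod1 (Psi c *m polar r) (Psi c *m polar s).
Proof. by apply/piN_eqP; rewrite piN_repr. Qed.

Lemma piND (s t : 'M[F]_6) : addN (piN Ur s) (piN Ur t) = piN Ur (s + t).
Proof.
apply/piN_eqP; have [ds ps] := repr_piN s; have [dt pt] := repr_piN t; split.
  by move=> k; rewrite !mxE ds dt.
rewrite !polarD ![_ *m (polar _ + _)]mulmxDr; apply: mod1_trans (mod1D _ ps) _.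
by rewrite addrC [X in mod1 _ X]addrC; apply: mod1D.
Qed.

Lemma oppN_id (a : N) : oppN a = a.
Proof. by rewrite /oppN oppmx_char2 piN_repr. Qed.

Lemma subN_add (a b : N) : subN a b = addN a b.
Proof. by rewrite /subN oppmx_char2. Qed.

Lemma addNC (a b : N) : addN a b = addN b a.
Proof. by rewrite /addN addrC. Qed.

Lemma addNA (a b d : N) : addN a (addN b d) = addN (addN a b) d.
Proof.
by rewrite -(piN_repr a) -(piN_repr b) -(piN_repr d) !piND addrA.
Qed.

Lemma add0N (a : N) : addN (zeroN Ur) a = a.
Proof. by rewrite -(piN_repr a) piND add0r. Qed.

Lemma addNN (a : N) : addN a a = zeroN Ur.
Proof. by rewrite -(piN_repr a) piND addmx_char2. Qed.

Lemma addN_K (a b : N) : addN (addN a b) b = a.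
Proof. by rewrite -addNA addNN addNC add0N. Qed.

(** The polarization transforms as a bilinear form and [Psi] is preserved by /\^2 g, so their
    product transforms as an endomorphism. *)
Lemma Psi_polar_act (g : 'M[F]_4) (s : 'M[F]_6) : \det g = 1 ->
  Psi c *m polar (actS g s) = invmx (wedge2 g) *m (Psi c *m polar s) *m wedge2 g.
Proof.
move=> dg; have ug : g \in unitmx by rewrite unitmxE dg unitr1.
have V : wedge2 (invmx g) *m wedge2 g = 1%:M by rewrite -wedge2M mulVmx // wedge2_1.
have [uV uG] := mulmx1_unit V.
have P : wedge2 g *m Psi c *m (wedge2 g)^T = Psi c.
  by rewrite Psi_klein -scalemxAr -scalemxAl wedge2_klein dg scale1r.
rewrite /actS polar_conj !mulmxA -[in RHS]P; congr (_ *m _ *m _).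
by rewrite !mulmxA mulVmx // mul1mx.
Qed.

Lemma wedge2_unit (g : 'M[F]_4) : \det g = 1 -> wedge2 g \in unitmx.
Proof.
move=> dg; have ug : g \in unitmx by rewrite unitmxE dg unitr1.
have V : wedge2 (invmx g) *m wedge2 g = 1%:M by rewrite -wedge2M mulVmx // wedge2_1.
by have [] := mulmx1_unit V.
Qed.

Lemma wedge2V (g : 'M[F]_4) : \det g = 1 -> wedge2 (invmx g) = invmx (wedge2 g).
Proof.
move=> dg; have ug : g \in unitmx by rewrite unitmxE dg unitr1.
have V : wedge2 (invmx g) *m wedge2 g = 1%:M by rewrite -wedge2M mulVmx // wedge2_1.
by rewrite -[RHS]mul1mx -V mulmxK // wedge2_unit.
Qed.

Lemma det_inv1 (g : 'M[F]_4) : \det g = 1 -> \det (invmx g) = 1.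
Proof. by move=> dg; rewrite det_inv dg invr1. Qed.

Lemma piN_alt (X : 'M[F]_6) : piN Ur (X - X^T) = zeroN Ur.
Proof.
apply/piN_eqP; split=> [k|]; first by rewrite !mxE subrr.
by left; rewrite polar_alt /polar trmx0 addr0.
Qed.

Lemma piN_U : piN Ur Ur = zeroN Ur.
Proof.
apply/piN_eqP; split=> [k|]; first by rewrite Urep_diag mxE.
by right; rewrite Psi_polar_U /polar trmx0 !addr0 mulmx0 add0r.
Qed.

Lemma actSD (g : 'M[F]_4) (s t : 'M[F]_6) : actS g (s + t) = actS g s + actS g t.
Proof. by rewrite /actS mulmxDr mulmxDl. Qed.

Lemma actSM (g h : 'M[F]_4) (s : 'M[F]_6) : actS (g *m h) s = actS h (actS g s).
Proof. by rewrite /actS wedge2M trmx_mul !mulmxA. Qed.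

Lemma actS1 (s : 'M[F]_6) : actS 1%:M s = s.
Proof. by rewrite /actS wedge2_1 trmx1 mul1mx mulmx1. Qed.

Lemma actN_pi (g : 'M[F]_4) (s : 'M[F]_6) : \det g = 1 ->
  actN g (piN Ur s) = piN Ur (actS g s).
Proof.
move=> dg; have /eqquotP /asboolP [n [X]] := piN_repr (piN Ur s).
rewrite mulmz_odd => /(canRL (subrK _)); rewrite /actN => ->.
rewrite 2!actSD -2!piND -[RHS]add0N; congr (addN _ _).
have -> : piN Ur (actS g (X - X^T)) = zeroN Ur.
  rewrite -(piN_alt (actS g X)); congr piN.
  by rewrite /actS !trmx_mul trmxK mulmxBr mulmxBl !mulmxA.
rewrite addNC add0N; case: odd; last by rewrite mulr0n /actS mulmx0 mul0mx.
(* The image of U is the same expression in the transformed vectors, so its diagonal still vanishes;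
   conjugation fixes the identity, to which U polarizes. *)
rewrite mulr1n -piN_U; apply/piN_eqP; split=> [k|]; first by rewrite -UrepM !Urep_diag.
by left; rewrite Psi_polar_act // Psi_polar_U mulmx1 mulVmx // wedge2_unit.
Qed.

Lemma actND (g : 'M[F]_4) (a b : N) : \det g = 1 ->
  actN g (addN a b) = addN (actN g a) (actN g b).
Proof.
move=> dg; rewrite -(piN_repr a) -(piN_repr b) piND !actN_pi //.
by rewrite actSD piND.
Qed.

Lemma actNM (g h : 'M[F]_4) (a : N) : \det g = 1 -> \det h = 1 ->
  actN (g *m h) a = actN h (actN g a).
Proof.
move=> dg dh; rewrite -(piN_repr a) !actN_pi ?actSM //.
by rewrite det_mulmx dg dh mulr1.
Qed.

Lemma actN1 (a : N) : actN 1%:M a = a.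
Proof. by rewrite -(piN_repr a) actN_pi ?det1 // actS1. Qed.

(** * The semidirect product of SL_4 and N and its action on the lift *)

Lemma mulVG (a : 'M[F]_4 * N) : inG a -> mulG (invG a) a = oneG Ur.
Proof.
move=> da; have ua : a.1 \in unitmx by rewrite unitmxE da unitr1.
rewrite /mulG /= mulVmx // oppN_id -actNM ?det_inv1 // mulVmx //.
by rewrite actN1 addNN.
Qed.

Lemma mulGV (a : 'M[F]_4 * N) : inG a -> mulG a (invG a) = oneG Ur.
Proof.
move=> da; have ua : a.1 \in unitmx by rewrite unitmxE da unitr1.
by rewrite /mulG /= mulmxV // oppN_id addNN.
Qed.

Lemma mulGA (a b d : 'M[F]_4 * N) : inG b -> inG d ->
  mulG a (mulG b d) = mulG (mulG a b) d.
Proof.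
move: a b d => [a k] [b l] [d m] /= db dd.
by rewrite /mulG /= mulmxA actND // addNA actNM.
Qed.

Lemma mul1G (a : 'M[F]_4 * N) : inG a -> mulG (oneG Ur) a = a.
Proof.
case: a => a k da; rewrite /mulG /= mul1mx /zeroN actN_pi //.
by rewrite /actS mulmx0 mul0mx add0N.
Qed.

Lemma mulG1 (a : 'M[F]_4 * N) : mulG a (oneG Ur) = a.
Proof. by case: a => a k; rewrite /mulG /= mulmx1 actN1 addNC add0N. Qed.

Lemma inG_mul (a b : 'M[F]_4 * N) : inG a -> inG b -> inG (mulG a b).
Proof. by rewrite /inG /= det_mulmx => -> ->; rewrite mulr1. Qed.

Lemma inG_inv (a : 'M[F]_4 * N) : inG a -> inG (invG a).
Proof. exact: det_inv1. Qed.

Lemma actLV_mul (a b x : 'M[F]_4 * N) : inG a -> inG b ->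
  actLV (mulG a b) x = actLV b (actLV a x).
Proof.
move: a b x => [a k] [b l] [T n]; rewrite /inG /actLV /= => da db.
have ua : a \in unitmx by rewrite unitmxE da unitr1.
have ub : b \in unitmx by rewrite unitmxE db unitr1.
congr pair; last by rewrite actND // addNA actNM.
have -> : invmx (a *m b) = invmx b *m invmx a.
  have V : invmx b *m invmx a *m (a *m b) = 1%:M.
    by rewrite mulmxA mulmxKV // mulVmx.
  have uab : a *m b \in unitmx by rewrite unitmx_mul ua.
  by rewrite -[RHS](mulmxK uab) V mul1mx.
by rewrite !mulmxA.
Qed.

Lemma actLV1 (x : 'M[F]_4 * N) : actLV (oneG Ur) x = x.
Proof.
case: x => T n; rewrite /actLV /= invmx1 mul1mx mulmx1 actN1.
by rewrite addNC add0N.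
Qed.

Lemma is_vtx_conj (g T : 'M[F]_4) : \det g = 1 ->
  is_vtx T -> is_vtx (invmx g *m T *m g).
Proof.
move=> dg [v [f [-> vf]]]; have ug : g \in unitmx by rewrite unitmxE dg unitr1.
exists (v *m g), (invmx g *m f); split; first by rewrite /tensor !mulmxA.
by rewrite /pairing !mulmxA mulmxK.
Qed.

(** * The potential and its invariance along darts *)

Definition idem (T : 'M[F]_4) := (\tr T)^-1 *: T.

Lemma idem_tensor v f : idem (tensor v f) = (pairing v f)^-1 *: (f *m v).
Proof. by rewrite /idem /tensor mxtrace_mulC trace_mx11. Qed.

Lemma idem_conj (g T : 'M[F]_4) : \det g = 1 ->
  idem (invmx g *m T *m g) = invmx g *m idem T *m g.
Proof.
move=> dg; have ug : g \in unitmx by rewrite unitmxE dg unitr1.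
by rewrite /idem mxtrace_mulC mulmxA mulmxV // mul1mx -scalemxAr -scalemxAl.
Qed.

(** The trace of v (x) f is f(v), so [1%:M + idem x.1] is the projection onto ker f along v. As
    [repr] is an arbitrary choice, the value is meaningful only up to [mod1]. *)
Definition potential (x : 'M[F]_4 * N) : 'M[F]_6 :=
  Psi c *m polar (repr x.2) + wedge2 (1%:M + idem x.1).

Lemma potential_pi T s :
  mod1 (potential (T, piN Ur s)) (Psi c *m polar s + wedge2 (1%:M + idem T)).
Proof. by apply: mod1D; case: (repr_piN s). Qed.

Lemma potential_act (a x : 'M[F]_4 * N) : inG a ->
  mod1 (potential (actLV a x))
    (invmx (wedge2 a.1) *m potential x *m wedge2 a.1 + Psi c *m polar (repr a.2)).
Proof.
move: a x => [a k] [T n] da; rewrite /= in da *.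
rewrite -[k]piN_repr -[n in actLV _ (_, n)]piN_repr /actLV /= actN_pi // piND.
apply: mod1_trans (potential_pi _ _) _.
have ua : a \in unitmx by rewrite unitmxE da unitr1.
have -> : 1%:M + idem (invmx a *m T *m a) = invmx a *m (1%:M + idem T) *m a.
  by rewrite idem_conj // mulmxDr mulmxDl mulmx1 mulVmx.
rewrite !wedge2M wedge2V // polarD [_ *m (polar _ + _)]mulmxDr Psi_polar_act //.
rewrite {1}/potential /= [in X in mod1 _ (X + _)]mulmxDr mulmxDl.
by rewrite addrAC piN_repr; left.
Qed.

(** This is [wedge_derivation] with f and g rescaled so that f(v) = g(u) = 1: adjacency kills the
    mixed terms, and the three remaining identities add up to one. *)
Lemma Psi_polar_ell v f u g : pairing v f != 0 -> pairing u g != 0 ->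
  pairing u f = 0 -> pairing v g = 0 ->
  Psi c *m polar (ell c v f u g) =
  wedge2 (1%:M + idem (tensor v f)) + wedge2 (1%:M + idem (tensor u g)) + 1%:M.
Proof.
move=> a0 b0 uf vg; rewrite !idem_tensor.
pose f' := (pairing v f)^-1 *: f; pose g' := (pairing u g)^-1 *: g.
have pZ (p : 'rV[F]_4) (h : 'cV[F]_4) e : pairing p (e *: h) = e * pairing p h.
  by rewrite /pairing -scalemxAr mxE.
have := wedge_derivation v u f' g'.
rewrite !pZ uf vg !mulr0 !mulVf // !scale1r !scale0r !subr0 mul1r !oppmx_char2.
rewrite -!scalemxAl => E.
have -> : ell c v f u g = sprod (wedge v u) (phi c (wedgeD f' g')).
  rewrite /ell /sprod /phi scalemxAr; congr (_ *m _); rewrite scalemxAl; congr (_ *m _).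
  by apply/rowP=> k; rewrite !mxE; ring.
have -> : Psi c *m polar (sprod (wedge v u) (phi c (wedgeD f' g'))) =
  (wedgeD f' g')^T *m wedge v u +
    (wedge v u *m klein F)^T *m (wedgeD f' g' *m klein F).
  rewrite /polar /sprod /phi invmx_Psi // mulmxDr addrC; congr (_ + _).
    rewrite !trmx_mul trmxK linearZ /= klein_tr !mulmxA Psi_mulV // mul1mx //.
  rewrite Psi_klein trmx_mul klein_tr -!scalemxAr -scalemxAl scalerA mulVf // scale1r.
  by rewrite !mulmxA.
rewrite E; set A := wedge2 _; set B := wedge2 _.
by rewrite -!addrA; congr (_ + _); rewrite [1%:M + (B + _)]addrCA addmx_char2 addr0.
Qed.

Lemma liftadj_potential (p q : 'M[F]_4 * N) :
  liftadj c p q -> mod1 (potential p) (potential q).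
Proof.
move: p q => [T n] [T' m] [_ [_ [v [f [u [g]]]]]] /= [-> [-> [vf [ug [uf [vg]]]]]].
rewrite /ellU /subN => /piN_eqP [_]; rewrite Psi_polar_ell // oppmx_char2 polarD.
rewrite [X in mod1 _ X]mulmxDr /potential /=.
exact: mod1_cross.
Qed.

(** * Walks, closed walks and the components of the lift *)

Lemma common_neighbour (v u : 'rV[F]_4) (f g : 'cV[F]_4) :
  pairing v f != 0 ->
  exists (p : 'rV[F]_4) (h : 'cV[F]_4),
    [/\ pairing p h != 0, pairing p f = 0, pairing p g = 0,
        pairing v h = 0 & pairing u h = 0].
Proof.
move=> vf; pose A := row_mx f g; pose B := col_mx v u.
(* Otherwise the common kernel of f and g, of dimension at least 2, lies in the span of v and u, of
   dimension at most 2. The two then coincide, and f(v) = 0. *)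
have nAB : ~~ (kermx A <= B)%MS.
  apply: contra vf => AB.
  have rB : (\rank B <= \rank (kermx A))%N.
    rewrite mxrank_ker (leq_trans (rank_leq_row B)) // -[X in (X <= _)%N]/(4 - 2)%N.
    by rewrite leq_sub2l // rank_leq_col.
  have BA : (B <= kermx A)%MS by rewrite -(geq_leqif (mxrank_leqif_sup AB)).
  have /sub_kermxP : (v <= kermx A)%MS.
    by apply: submx_trans BA; rewrite -addsmxE addsmxSl.
  rewrite mul_mx_row => E; have : lsubmx (row_mx (v *m f) (v *m g)) = 0.
    by rewrite E; apply/matrixP=> i j; rewrite !mxE.
  by rewrite row_mxKl /pairing => ->; rewrite mxE.
(* A nonzero entry here pairs a vector killed by f and g with a functional killing v and u. *)
have /matrix0Pn[i [j ij]] : kermx A *m cokermx B != 0 by rewrite -submxE.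
exists (row i (kermx A)), (col j (cokermx B)).
have kA : row i (kermx A) *m row_mx f g = 0 by rewrite -row_mul mulmx_ker row0.
have cB : col_mx v u *m col j (cokermx B) = 0 by rewrite colE mulmxA mulmx_coker mul0mx.
move: kA; rewrite mul_mx_row -[RHS]row_mx0 => /eq_row_mx[kf kg].
move: cB; rewrite mul_col_mx -[RHS]col_mx0 => /eq_col_mx[vc uc].
split.
- apply: contra ij => /eqP; rewrite /pairing !mxE => E; apply/eqP.
  by rewrite -[RHS]E; apply: eq_bigr => k _; rewrite !mxE.
- by rewrite /pairing kf mxE.
- by rewrite /pairing kg mxE.
- by rewrite /pairing vc mxE.
- by rewrite /pairing uc mxE.
Qed.

(** Both wedges change sign; in characteristic 2 this symmetry is the antisymmetry required of a
    voltage. *)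
Lemma ell_sym v f u g : ell c v f u g = ell c u g v f.
Proof.
rewrite /ell mulrC; congr (_ *: _).
have -> : wedge v u = - wedge u v by apply/rowP=> k; rewrite !mxE; ring.
have -> : wedgeD f g = - wedgeD g f by apply/rowP=> k; rewrite !mxE; ring.
by rewrite /sprod /phi [(- wedge u v)^T]linearN /= !mulNmx mulmxN opprK.
Qed.

Lemma liftadj_ell v f u g n : pairing v f != 0 -> pairing u g != 0 ->
  pairing u f = 0 -> pairing v g = 0 ->
  liftadj c (tensor v f, n) (tensor u g, addN n (piN Ur (ell c v f u g))).
Proof.
move=> vf ug uf vg; split; [by exists v, f | split; first by exists u, g].
exists v, f, u, g; do !split=> //.
by rewrite subN_add addNA addNN add0N.
Qed.

Lemma compG_adj (p q : 'M[F]_4 * N) : liftadj c p q -> compG c p q.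
Proof. by move=> H; apply: rt_step; left. Qed.

Lemma compG_trans (q p r : 'M[F]_4 * N) : compG c p q -> compG c q r -> compG c p r.
Proof. exact: rt_trans. Qed.

(** Two darts through a common neighbour. One t serves all n and both directions, because N has
    exponent 2. *)
Lemma common_walk S T : is_vtx S -> is_vtx T -> exists t : N, forall n : N,
  compG c (S, n) (T, addN n t) /\ compG c (T, n) (S, addN n t).
Proof.
move=> [v [f [-> vf]]] [u [g [-> ug]]].
have [p [h [ph pf pg vh uh]]] := common_neighbour u g vf.
exists (addN (piN Ur (ell c v f p h)) (piN Ur (ell c u g p h))) => n; split.
- rewrite addNA; apply: compG_trans (compG_adj (liftadj_ell n vf ph pf vh)) _.
  by apply: compG_adj; rewrite (ell_sym u); apply: liftadj_ell.
- rewrite [addN (piN _ _) _]addNC addNA.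
  apply: compG_trans (compG_adj (liftadj_ell n ug ph pg uh)) _.
  by apply: compG_adj; rewrite (ell_sym v); apply: liftadj_ell.
Qed.

Lemma wedgeD_evec k :
  wedgeD (evec F (wi k))^T (evec F (wj k))^T = delta_mx 0 k.
Proof. by rewrite -wedge_evec; apply/rowP=> l; rewrite !mxE. Qed.

Lemma pairing_evec i j : pairing (evec F i) (evec F j)^T = (i == j)%:R.
Proof. by rewrite /pairing /evec trmx_delta -colE !mxE eqxx eq_sym. Qed.

Lemma rev_inord6 k : (k < 6)%N -> rev_ord (inord k : 'I_6) = inord (5 - k).
Proof. by move=> hk; apply: val_inj; rewrite /= !inordK // ltnS leq_subr. Qed.

Lemma wij_rev_uniq (k : 'I_6) :
  uniq [:: wi k; wj k; wi (rev_ord k); wj (rev_ord k)].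
Proof.
by elim/ord6_ind: k; rewrite /= rev_inord6 // !wedge_indexE //= !inE !inord4_eq.
Qed.

Lemma delta_klein k : (delta_mx 0 (rev_ord k) : 'rV[F]_6) *m klein F = delta_mx 0 k.
Proof.
apply/rowP=> l; elim/ord6_ind: l; rewrite mul_kleinE //= mxE [RHS]mxE eqxx /=;
  rewrite ?expr0 ?expr1 ?mulN1r ?mul1r ?oppr_char2;
  elim/ord6_ind: k; rewrite rev_inord6 // !inord6_eq //.
Qed.

(** The mixed second difference of a bilinear map, with signs dropped; it yields the total voltage
    of a quadrangle. *)
Lemma wedgeD_square (a a' b b' : 'cV[F]_4) :
  wedgeD a b + wedgeD (a + a') b + wedgeD (a + a') (b + b') + wedgeD a (b + b')
  = wedgeD a' b'.
Proof.
pose X := wedgeD a b + wedgeD a b + wedgeD a' b + wedgeD a b'.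
rewrite -[RHS]addr0 -(addmx_char2 X); apply/rowP=> k; rewrite !mxE; ring.
Qed.

Definition loops (s : 'M[F]_6) := forall T (n : N), is_vtx T ->
  compG c (T, n) (T, addN n (piN Ur s)).

(** Conjugate the closed walk at T by a walk from S to T: the two shifts t cancel. *)
Lemma loops_at s T : is_vtx T ->
  (forall n : N, compG c (T, n) (T, addN n (piN Ur s))) -> loops s.
Proof.
move=> vT H S n vS; have [t St] := common_walk vS vT.
have [p1 _] := St n; apply: compG_trans p1 _; apply: compG_trans (H _) _.
have [_ p2] := St (addN (addN n t) (piN Ur s)).
have -> // : addN n (piN Ur s) = addN (addN (addN n t) (piN Ur s)) t.
by rewrite -(addNA n) (addNC t) addNA addN_K.
Qed.

(* The quadrangle e_i (x) f_i, e_j (x) f_j, e_i (x) (f_i + c a f_i'),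
   e_j (x) (f_j + f_j'), where f is the dual basis and {i, j, i', j'} = {0, 1, 2, 3}. *)
Lemma loops_delta k (a : F) : loops (a *: delta_mx k k).
Proof.
pose e i := evec F i; pose f i := (evec F i)^T.
set i := wi k; set j := wj k; set i' := wi (rev_ord k); set j' := wj (rev_ord k).
have := wij_rev_uniq k; rewrite -/i -/j -/i' -/j' /= !inE !negb_or.
case/and4P => /and3P[ij ii' ij'] /andP[ji' jj'] i'j' _.
(* The factor c cancels the c^-1 of [phi], and the complementary pair i', j' is the one that [phi]
   sends to a multiple of e_i /\ e_j. *)
pose f3 := f i + (c * a) *: f i'; pose f4 := f j + f j'.
have pD (v : 'rV[F]_4) (h h' : 'cV[F]_4) b :
    pairing v (h + b *: h') = pairing v h + b * pairing v h'.
  by rewrite /pairing mulmxDr -scalemxAr !mxE.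
have p1 : pairing (e i) (f i) = 1 by rewrite pairing_evec eqxx.
have p2 : pairing (e j) (f j) = 1 by rewrite pairing_evec eqxx.
have p3 : pairing (e i) f3 = 1.
  by rewrite pD p1 pairing_evec (negPf ii') mulr0 addr0.
have p4 : pairing (e j) f4 = 1.
  by rewrite /f4 -[f j']scale1r pD p2 pairing_evec (negPf jj') mulr0 addr0.
have q12 : pairing (e i) (f j) = 0 by rewrite pairing_evec (negPf ij).
have q21 : pairing (e j) (f i) = 0 by rewrite pairing_evec eq_sym (negPf ij).
have q23 : pairing (e j) f3 = 0.
  by rewrite pD q21 pairing_evec (negPf ji') mulr0 addr0.
have q14 : pairing (e i) f4 = 0.
  by rewrite /f4 -[f j']scale1r pD q12 pairing_evec (negPf ij') mulr0 addr0.
have n0 (v : 'rV[F]_4) (h : 'cV[F]_4) : pairing v h = 1 -> pairing v h != 0.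
  by move=> ->; exact: oner_neq0.
apply: (@loops_at _ (tensor (e i) (f i))).
  by exists (e i), (f i); split=> //; apply: n0.
move=> n.
apply: compG_trans (compG_adj (liftadj_ell n (n0 _ _ p1) (n0 _ _ p2) q21 q12)) _.
apply: compG_trans (compG_adj (liftadj_ell _ (n0 _ _ p2) (n0 _ _ p3) q12 q23)) _.
apply: compG_trans (compG_adj (liftadj_ell _ (n0 _ _ p3) (n0 _ _ p4) q23 q14)) _.
have -> : a *: delta_mx k k = ell c (e i) (f i) (e j) (f j) + ell c (e j) (f j) (e i) f3
  + ell c (e i) f3 (e j) f4 + ell c (e j) f4 (e i) (f i).
  rewrite (ell_sym (e j) (f j)) (ell_sym (e j) f4) /ell p1 p2 p3 p4.
  rewrite !invr1 !mulr1 !scale1r.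
  rewrite /sprod /phi -!mulmxDr -!mulmxDl wedgeD_square.
  have -> : wedgeD ((c * a) *: f i') (f j') = (c * a) *: wedgeD (f i') (f j').
    by apply/rowP=> l; rewrite !mxE; ring.
  rewrite wedgeD_evec wedge_evec invmx_Psi // -!scalemxAl -!scalemxAr delta_klein.
  rewrite trmx_delta mul_delta_mx scalerA; congr (_ *: _).
  by rewrite mulrAC mulfV ?mul1r.
rewrite -!piND !addNA; apply: compG_adj.
exact: liftadj_ell (n0 _ _ p4) (n0 _ _ p1) q14 q21.
Qed.

Lemma loops_diag (d : 'rV[F]_6) : loops (diag_mx d).
Proof.
have -> : diag_mx d = \sum_k d 0 k *: delta_mx k k by exact: diag_mx_sum_delta.
apply: (big_ind loops) => [T n _ | s t Hs Ht T n vT | k _]; last exact: loops_delta.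
- by rewrite addNC [addN _ _]add0N; apply: rt_refl.
- by rewrite -piND addNA; apply: compG_trans (Hs _ _ vT) (Ht _ _ vT).
Qed.

Lemma compG_potential (p q : 'M[F]_4 * N) :
  compG c p q -> mod1 (potential p) (potential q).
Proof.
elim=> {p q} [p q [/liftadj_potential // | [vp [_ pq]]] | p | p r q _ pr _ rq].
(* For equal neighbourhoods, compare p and q with a neighbour r of p, obtained as a common neighbour
   of its vertex with itself. *)
- case: p vp pq => T n [v [f [/= -> vf]]] pq.
  have [u [g [ug uf _ vg _]]] := common_neighbour v f vf.
  have pr := liftadj_ell n vf ug uf vg.
  have [_ [vr _]] := pr; have qr := (pq _ vr).1 pr.
  exact: mod1_trans (liftadj_potential pr) (mod1_sym (liftadj_potential qr)).
- by left.
- exact: mod1_trans pr rq.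
Qed.

(** For the converse, walk from p into the fibre of q. Equal potentials then leave a difference with
    trivial polarization, a diagonal class, which [loops_diag] absorbs. *)
Lemma compGP (p q : 'M[F]_4 * N) : isLV p -> isLV q ->
  compG c p q <-> mod1 (potential p) (potential q).
Proof.
move=> vp vq; split; first exact: compG_potential.
case: p q vp vq => [S n] [T m] vS vT e; have [t /(_ n)[pt _]] := common_walk vS vT.
have {e} := mod1_trans (mod1_sym (compG_potential pt)) e.
move=> /(mod1D (wedge2 (1%:M + idem T))); rewrite /potential /=.
rewrite -!addrA addmx_char2 !addr0 => e.
apply: compG_trans pt _.
pose s := repr (addN n t).
have := @loops_diag (\row_k (repr m k k - s k k)) T (addN n t) vT.
have -> // : addN (addN n t) (piN Ur (diag_mx (\row_k (repr m k k - s k k)))) = m.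
rewrite -[addN n t]piN_repr -/s piND -[RHS]piN_repr; apply/piN_eqP; split.
  by move=> k; rewrite !mxE eqxx mulr1n addrC subrK.
by rewrite polarD polar_diag addr0.
Qed.

(** * The stabilizer of a component *)

Lemma isLV_act (a p : 'M[F]_4 * N) : inG a -> isLV p -> isLV (actLV a p).
Proof. by move=> da; apply: is_vtx_conj. Qed.

Lemma potential_act_mod (a p q : 'M[F]_4 * N) : inG a ->
  mod1 (potential p) (potential q) <->
  mod1 (potential (actLV a p)) (potential (actLV a q)).
Proof.
move=> da; have ua := wedge2_unit da.
have hp := potential_act p da; have hq := potential_act q da; split=> e.
  apply: mod1_trans hp _; apply: mod1_trans (mod1_sym hq).
  by apply: mod1D; apply: mod1_conj.
have {e} := mod1_trans (mod1_sym hp) (mod1_trans e hq).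
move=> /(mod1D (Psi c *m polar (repr a.2))); rewrite -!addrA addmx_char2 !addr0.
exact: mod1_conjE.
Qed.

(** The group permutes the level sets of the potential modulo the identity, so one point of the
    component suffices as a test. *)
Lemma stabP (p a : 'M[F]_4 * N) : isLV p ->
  stabComp c p a <-> inG a /\ mod1 (potential p) (potential (actLV a p)).
Proof.
move=> vp; split=> [[da H] | [da e]]; split=> //.
  by apply/compG_potential/(H p vp).1; exact: rt_refl.
move=> q vq; rewrite (compGP vp vq) (compGP vp (isLV_act da vq)).
split=> [pq | pq].
  exact: mod1_trans e ((potential_act_mod p q da).1 pq).
by apply/(potential_act_mod p q da); apply: mod1_trans (mod1_sym e) pq.
Qed.

Lemma stab_mul (p a b : 'M[F]_4 * N) :
  stabComp c p a -> stabComp c p b -> stabComp c p (mulG a b).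
Proof.
move=> [da Ha] [db Hb]; split; first exact: inG_mul.
move=> q vq; rewrite actLV_mul // (Ha q vq); apply: Hb; exact: isLV_act.
Qed.

Lemma stab_inv (p a : 'M[F]_4 * N) : stabComp c p a -> stabComp c p (invG a).
Proof.
move=> [da Ha]; have di := inG_inv da; split=> // q vq.
by rewrite (Ha _ (isLV_act di vq)) -actLV_mul // mulVG // actLV1.
Qed.

Lemma stab_lift p (g : 'M[F]_4) : isLV p -> \det g = 1 ->
  exists k : N, stabComp c p (g, k).
Proof.
case: p => T n vT dg; have [t /(_ n)[pt _]] := common_walk vT (is_vtx_conj dg vT).
(* Chosen so that n^g + k = n + t, the end of a walk from (T, n) to the fibre of T^g. *)
exists (addN (actN g n) (addN n t)); apply/stabP => //; split=> //.
by apply: compG_potential; rewrite /actLV /= addNA addNN add0N.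
Qed.

(** Translation by k adds [Psi] times the polarization of k to the potential. This is trivial modulo
    the identity exactly when k is a combination of the squares of the basis of W. *)
Lemma stab_translation p (k : N) : isLV p ->
  stabComp c p (1%:M, k) <-> exists u : 'rV[F]_6, k = piN Ur (diag_mx u).
Proof.
move=> vp; have d1 : inG (1%:M, k) by rewrite /inG /= det1.
have e := potential_act p d1; rewrite /= wedge2_1 invmx1 mul1mx mulmx1 in e.
have -> : stabComp c p (1%:M, k) <-> mod1 (Psi c *m polar (repr k)) 0.
  rewrite stabP //; split=> [[_ h] | h]; last split=> //.
    have := mod1D (potential p) (mod1_trans h e).
    by rewrite addmx_char2 addrAC addmx_char2 add0r; apply: mod1_sym.
  apply: mod1_trans (mod1_sym e).
  by rewrite [potential p + _]addrC -[X in mod1 X _]add0r; apply/mod1_sym/mod1D.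
split=> [h | [u ->]].
  exists (\row_i repr k i i); rewrite -[LHS]piN_repr; apply/piN_eqP.
  by split=> [i|]; rewrite ?polar_diag ?mulmx0 // !mxE eqxx mulr1n.
by have [_] := repr_piN (diag_mx u); rewrite polar_diag mulmx0.
Qed.

(** * Commuting transvections and the obstruction to a splitting *)

Definition transv (i j : nat) (a : F) : 'M[F]_4 :=
  1%:M + a *: delta_mx (inord i) (inord j).

Lemma transv_comm (a b : F) : transv 0 2 a *m transv 1 3 b = transv 1 3 b *m transv 0 2 a.
Proof.
rewrite /transv !mulmxDl !mulmxDr !mul1mx !mulmx1 -!scalemxAl -!scalemxAr.
rewrite !mul_delta_mx_0 ?inord4_eq // !scaler0 !addr0.
by rewrite -!addrA [_ *: _ + _ *: _]addrC.
Qed.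

Lemma transv_det (i j : nat) (a : F) : (i < j < 4)%N -> \det (transv i j a) = 1.
Proof.
case/andP=> ij j4; rewrite -det_tr det_trig.
  rewrite big1 // => k _; rewrite !mxE eqxx -!val_eqE /= !inordK ?(ltn_trans ij) //.
  by case: eqP => [->|_]; rewrite ?(ltn_eqF ij) ?mulr0 ?addr0.
apply/is_trig_mxP=> k l kl; rewrite !mxE -!val_eqE /= !inordK ?(ltn_trans ij) //.
rewrite gtn_eqF // add0r; case: eqP => [lj|_]; last by rewrite mulr0.
case: eqP => [ki|_]; last by rewrite mulr0.
by move: kl; rewrite lj ki ltnNge (ltnW ij).
Qed.

(** Index 5 is e_2 /\ e_3. Since e_0 goes to e_0 + a e_2, the only other basis bivector contributing
    to it is e_0 /\ e_3, of index 2. *)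
Lemma wedge2_transv02 (a : F) k : wedge2 (transv 0 2 a) k (inord 5) =
  (k == inord 5)%:R + a * (k == inord 2)%:R.
Proof.
elim/ord6_ind: k; rewrite !mxE !wedge_indexE //= !inord4_eq // !inord6_eq //=; ring.
Qed.

Lemma wedge2_transv13 (a : F) k : wedge2 (transv 1 3 a) k (inord 5) =
  (k == inord 5)%:R + a * (k == inord 3)%:R.
Proof.
rewrite -[in RHS](oppr_char2 a).
elim/ord6_ind: k; rewrite !mxE !wedge_indexE //= !inord4_eq // !inord6_eq //=; ring.
Qed.

(** The quadratic form of s evaluated at column i of G, which is the i-th unit vector plus a times
    the j-th. *)
Lemma quad_delta2 (G s : 'M[F]_6) (a : F) (i j : 'I_6) :
  (forall k, G k i = (k == i)%:R + a * (k == j)%:R) ->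
  (G^T *m s *m G) i i = s i i + a ^+ 2 * s j j + a * polar s j i.
Proof.
move=> GE; have sumE (f : 'I_6 -> F) : \sum_k f k * G k i = f i + a * f j.
  have S l : \sum_k f k *+ (k == l) = f l.
    rewrite (bigD1 l) //= eqxx big1 ?addr0 // => k /negPf -> //.
  rewrite -[f i]S -[f j]S mulr_sumr -big_split; apply: eq_bigr => k _ /=.
  by rewrite GE mulrDr mulrCA !mulr_natr.
rewrite mxE sumE ![in LHS]mxE.
have H k : \sum_j0 G^T i j0 * s j0 k = s i k + a * s j k.
  by rewrite -(sumE (s^~ k)); apply: eq_bigr => l _; rewrite mxE mulrC.
rewrite !H; have -> : polar s j i = s j i + s i j by rewrite !mxE.
ring.
Qed.

Definition base : 'M[F]_4 := tensor (evec F (inord 0)) (evec F (inord 0))^T.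

Lemma base_vtx : is_vtx base.
Proof. by do 2!eexists; split; rewrite // pairing_evec eqxx oner_neq0. Qed.

Lemma idem_base : idem base = delta_mx (inord 0) (inord 0).
Proof.
by rewrite idem_tensor pairing_evec eqxx invr1 scale1r /evec trmx_delta mul_delta_mx.
Qed.

Lemma conj_eq n (g X Y : 'M[F]_n) : g \in unitmx -> X *m g = g *m Y ->
  invmx g *m X *m g = Y.
Proof. by move=> ug e; rewrite -mulmxA e mulKmx. Qed.

(** Here k' represents the N-part of (g, k) conjugated by the translation by n, which moves the base
    point to (base, 0). Its polarization only sees how g moves the idempotent of the base vertex. *)
Lemma normalised_cocycle (n : N) (g : 'M[F]_4) (k : N) : \det g = 1 ->
  mod1 (potential (base, n)) (potential (actLV (g, k) (base, n))) ->
  let k' := repr k + actS g (repr n) + repr n in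
  mod1 (Psi c *m polar k')
    (wedge2 (invmx g *m (1%:M + idem base) *m g) + wedge2 (1%:M + idem base)).
Proof.
move=> dg e k'; have {e} := mod1_trans e (@potential_act (g, k) (base, n) dg).
rewrite !wedge2M wedge2V //= /potential /= !polarD.
rewrite ![Psi c *m (_ + polar _)]mulmxDr Psi_polar_act //.
set E := wedge2 (_ + _); set P := Psi c *m polar (repr n).
set K := Psi c *m _; set G := wedge2 g.
rewrite [invmx G *m (P + E)]mulmxDr mulmxDl.
move=> /(mod1D (E + K + invmx G *m P *m G)).
set A := invmx G *m P *m G; set B := invmx G *m E *m G.
have -> : P + E + (E + K + A) = K + A + P.
  by rewrite (AC (2*3) (((2*3)*4)*5*1)) /= addmx_char2 add0r.
have -> // : A + B + K + (E + K + A) = B + E.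
by rewrite (AC (3*3) (((1*6)*(3*5))*(2*4))) /= !addmx_char2 !add0r.
Qed.

Lemma klein_mul23 (X : 'M[F]_6) k :
  (klein F *m X) (inord 2) k = X (inord 3) k /\
  (klein F *m X) (inord 3) k = X (inord 2) k.
Proof. by rewrite !mxE !sum_inord6 !mxE !inordK //=; split; ring. Qed.

(** Conjugation by g turns E_00 into E_00 + a E_02. The entry (2, 5) is off the diagonal, hence
    blind to the identity in [mod1], and [klein] exchanges rows 2 and 3. *)
Lemma cocycle02 (a : F) (s : 'M[F]_6) : let g := transv 0 2 a in
  mod1 (Psi c *m polar s)
    (wedge2 (invmx g *m (1%:M + idem base) *m g) + wedge2 (1%:M + idem base)) ->
  c * polar s (inord 3) (inord 5) = a.
Proof.
move=> g; have ug : g \in unitmx by rewrite unitmxE transv_det ?unitr1.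
rewrite idem_base (@conj_eq _ _ _ (1%:M + delta_mx (inord 0) (inord 0)
  + a *: delta_mx (inord 0) (inord 2))) //.
  set Y := _ + _ *: _; set Z := 1%:M + delta_mx _ _ in Y *.
  have Y25 : (wedge2 Y + wedge2 Z) (inord 2) (inord 5) = a.
    by rewrite !mxE !wedge_indexE //= !inord4_eq //=; ring.
  have E : (Psi c *m polar s) (inord 2) (inord 5) = c * polar s (inord 3) (inord 5).
    by rewrite Psi_klein -scalemxAl mxE (klein_mul23 _ _).1.
  rewrite -E; case=> ->; rewrite ?[(_ + 1%:M) _ _]mxE Y25 //.
  by rewrite mxE inord6_eq // addr0.
rewrite /g /transv !mulmxDl !mulmxDr !mul1mx !mulmx1 -!scalemxAl -!scalemxAr.
rewrite !mul_delta_mx !mul_delta_mx_0 ?inord4_eq // !scaler0 !addr0.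
by rewrite addrACA addrA.
Qed.

(** This transvection fixes the base vertex, so the right-hand side cancels. *)
Lemma cocycle13 (a : F) (s : 'M[F]_6) : let g := transv 1 3 a in
  mod1 (Psi c *m polar s)
    (wedge2 (invmx g *m (1%:M + idem base) *m g) + wedge2 (1%:M + idem base)) ->
  polar s (inord 2) (inord 5) = 0.
Proof.
move=> g; have ug : g \in unitmx by rewrite unitmxE transv_det ?unitr1.
rewrite idem_base (@conj_eq _ _ _ (1%:M + delta_mx (inord 0) (inord 0))) //.
  rewrite addmx_char2 => H; apply: (mulfI c0); rewrite mulr0.
  have <- : (Psi c *m polar s) (inord 3) (inord 5) = c * polar s (inord 2) (inord 5).
    by rewrite Psi_klein -scalemxAl mxE (klein_mul23 _ _).2.
  by case: H => ->; rewrite !mxE ?inord6_eq // addr0.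
rewrite /g /transv !mulmxDl !mulmxDr !mul1mx !mulmx1 -!scalemxAl -!scalemxAr.
by rewrite !mul_delta_mx_0 ?inord4_eq // !scaler0 !addr0 addrAC.
Qed.

(** Commutation reads k^h + l = l^g + k. Passing to k' and l', the terms in n cancel because gh =
    hg; the cross term of [quad_delta2] is a b / c for k' and 0 for l'. *)
Lemma commuting_lifts (n k l : N) (a b : F) :
  let g := transv 0 2 a in let h := transv 1 3 b in
  mod1 (potential (base, n)) (potential (actLV (g, k) (base, n))) ->
  mod1 (potential (base, n)) (potential (actLV (h, l) (base, n))) ->
  mulG (g, k) (h, l) = mulG (h, l) (g, k) ->
  let k' := repr k + actS g (repr n) + repr n in
  let l' := repr l + actS h (repr n) + repr n in
  a * b / c = b ^+ 2 * k' (inord 3) (inord 3) + a ^+ 2 * l' (inord 2) (inord 2).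
Proof.
move=> g h Hk Hl [_ ekl] k' l'.
have dg : \det g = 1 by apply: transv_det.
have dh : \det h = 1 by apply: transv_det.
have pk := cocycle02 (normalised_cocycle dg Hk).
have pl := cocycle13 (normalised_cocycle dh Hl).
rewrite -/k' -/l' in pk pl.
move: ekl; rewrite /= -[k]piN_repr -[l]piN_repr !actN_pi // !piND.
move=> /piN_eqP[/(_ (inord 5))].
(* The coefficient of the square of e_2 /\ e_3, a diagonal entry and so well defined on N. *)
move=> e _; pose p (X : 'M[F]_6) := X (inord 5) (inord 5).
have pD X Y : p (X + Y) = p X + p Y by rewrite /p mxE.
have {e} : p (actS h (repr k)) + p (repr l) = p (actS g (repr l)) + p (repr k).
  by rewrite -!pD.
have -> : p (actS h (repr k)) =
    p (actS h k') + p (actS (g *m h) (repr n)) + p (actS h (repr n)).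
  rewrite -!pD; congr p; rewrite actSM -!actSD /k'.
  by rewrite (AC (3*1*1) (1*(2*4)*(3*5))) /= !addmx_char2 !addr0.
have -> : p (actS g (repr l)) =
    p (actS g l') + p (actS (g *m h) (repr n)) + p (actS g (repr n)).
  rewrite -!pD; congr p; rewrite /g /h transv_comm -/g -/h actSM -!actSD /l'.
  by rewrite (AC (3*1*1) (1*(2*4)*(3*5))) /= !addmx_char2 !addr0.
have -> : p (repr k) = p k' + p (actS g (repr n)) + p (repr n).
  by rewrite -!pD; congr p; rewrite /k' (AC (3*1*1) (1*(2*4)*(3*5))) /= !addmx_char2 !addr0.
have -> : p (repr l) = p l' + p (actS h (repr n)) + p (repr n).
  by rewrite -!pD; congr p; rewrite /l' (AC (3*1*1) (1*(2*4)*(3*5))) /= !addmx_char2 !addr0.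
have -> : p (actS h k') = p k' + b ^+ 2 * k' (inord 3) (inord 3) + a * b / c.
  rewrite /p /actS (quad_delta2 _ (wedge2_transv13 b)) -pk; congr (_ + _).
  by field.
have -> : p (actS g l') = p l' + a ^+ 2 * l' (inord 2) (inord 2).
  by rewrite /p /actS (quad_delta2 _ (wedge2_transv02 a)) pl mulr0 addr0.
set q1 := p (actS (_ *m _) _); set q2 := p (actS h _); set q3 := p (repr n).
set q4 := p (actS g _); set K := b ^+ 2 * _; set L := a ^+ 2 * _; set P := a * b / c.
move: (p k') (p l') q1 q2 q3 q4 K L P => r1 r2 q1 q2 q3 q4 K L P.
move/eqP; rewrite -subr_eq0 => /eqP H0.
apply/eqP; rewrite -subr_eq0; apply/eqP.
(* As integral polynomials the two sides differ by twice q4 - q2 - K, supplied here as a zero. *)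
rewrite -[RHS](addr_char2 (q4 - q2 - K)) -[RHS]add0r -H0; ring.
Qed.

(** The component of p meets the fibre over the base vertex, so the computations there apply to any
    component. *)
Lemma stab_base (p : 'M[F]_4 * N) : isLV p -> exists n : N, forall a,
  stabComp c p a -> mod1 (potential (base, n)) (potential (actLV a (base, n))).
Proof.
case: p => T m vp; have [t /(_ m)[pt _]] := common_walk vp base_vtx.
exists (addN m t) => a [_ H].
apply: mod1_trans (mod1_sym (compG_potential pt)) _.
by apply: compG_potential; apply/(H (base, addN m t) base_vtx).1.
Qed.

Lemma commuting_family_trivial (e d : F) (P Q : F -> F) : e != 0 -> d != 0 ->
  (forall a b, a * b / d = b ^+ 2 * P a + a ^+ 2 * Q b) -> e = 1.
Proof.
move=> e0 d0 H; pose D a b := a * b / d - (b ^+ 2 * P a + a ^+ 2 * Q b).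
have D0 a b : D a b = 0 by rewrite /D H subrr.
have : e ^+ 2 * (e - 1) ^+ 2 / d = 0.
  (* The combination that eliminates the four unknowns P(1), P(e), Q(1) and Q(e). *)
  transitivity (D e e - e ^+ 2 * D 1 e - e ^+ 2 * D e 1 + e ^+ 4 * D 1 1).
    by rewrite /D; ring.
  by rewrite !D0 !mulr0 !subr0 addr0.
move/eqP; rewrite mulf_eq0 invr_eq0 (negPf d0) orbF mulf_eq0 !expf_eq0 /=.
by rewrite (negPf e0) subr_eq0 => /eqP.
Qed.

Lemma stab_nonsplit (e : F) (p : 'M[F]_4 * N) (C : 'M[F]_4 * N -> Prop) :
  e != 0 -> e != 1 -> isLV p ->
  (forall h, C h -> stabComp c p h) -> subgroupG C ->
  (forall h, C h -> h.1 = 1%:M -> h = oneG Ur) ->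
  ~ (forall g : 'M[F]_4, \det g = 1 -> exists k, C (g, k)).
Proof.
move=> e0 e1 vp CH [_ CM CV] CK CS.
have Cg h : C h -> inG h by move=> /CH [].
(* C embeds in SL_4: the quotient of ab by ba lies in C over the identity matrix, hence is
   trivial. *)
have comm (a b : 'M[F]_4 * N) : C a -> C b -> a.1 *m b.1 = b.1 *m a.1 ->
    mulG a b = mulG b a.
  move=> Ca Cb ab; have Cba := CM _ _ Cb Ca; have Cab := CM _ _ Ca Cb.
  have := CK _ (CM _ _ (CV _ Cba) Cab).
  have -> : (mulG (invG (mulG b a)) (mulG a b)).1 = 1%:M.
    by rewrite /= ab mulVmx // unitmxE (Cg _ Cba) unitr1.
  move=> /(_ erefl) E; have gab := Cg _ Cab; have gba := Cg _ Cba.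
  by rewrite -[LHS]mul1G // -(mulGV gba) -mulGA ?E ?mulG1 //; apply: inG_inv.
have [n Hn] := stab_base vp.
have /choice[P CP] : forall a, exists k, C (transv 0 2 a, k).
  by move=> a; apply: CS; apply: transv_det.
have /choice[Q CQ] : forall a, exists k, C (transv 1 3 a, k).
  by move=> a; apply: CS; apply: transv_det.
have /eqP ne1 := e1; apply: ne1.
pose P' a := (repr (P a) + actS (transv 0 2 a) (repr n) + repr n) (inord 3) (inord 3).
pose Q' a := (repr (Q a) + actS (transv 1 3 a) (repr n) + repr n) (inord 2) (inord 2).
apply: (@commuting_family_trivial e c P' Q') => // a b.
apply: commuting_lifts; [exact/Hn/CH | exact/Hn/CH | apply: comm => //].
exact: transv_comm.
Qed.

Theorem stab_nonsplit_ext (e : F) (p : 'M[F]_4 * N) : e != 0 -> e != 1 -> isLV p ->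
  nonsplit_ext_SL4_by_F6 (stabComp c p).
Proof.
(* The normal subgroup is the kernel of the projection to SL_4; diagonal matrices parametrize it by
   F^6. *)
move=> e0 e1 vp; exists (fun a => stabComp c p a /\ a.1 = 1%:M); split.
- by move=> k [].
- move=> h k Hh [Hk k1]; split; first by apply: stab_mul (stab_inv Hh) (stab_mul Hk Hh).
  by rewrite /= k1 mul1mx mulVmx // unitmxE Hh.1 unitr1.
- exists (fun u => (1%:M, piN Ur (diag_mx u))); split.
  + move=> u v [/piN_eqP[E _]]; apply/rowP=> i.
    by have := E i; rewrite !mxE eqxx !mulr1n.
  + move=> [g k]; split=> [[/= H g1] | [u [-> ->]]].
      by rewrite g1 in H *; have [u ->] := (stab_translation k vp).1 H; exists u.
    by split=> //; apply/stab_translation => //; exists u.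
  + move=> u v; rewrite /mulG /= mul1mx actN1 piND; congr (_, piN _ _).
    by apply/matrixP=> i j; rewrite !mxE mulrnDl.
- exists fst; split=> [h [] // | // | s ds | h Hh].
    by have [k Hk] := stab_lift vp ds; exists (s, k).
  by split=> [|[]].
- move=> [C [CH SC CK CS]]; apply: (stab_nonsplit e0 e1 vp CH SC).
    by move=> h Ch h1; apply: CK => //; split=> //; apply: CH.
  (* A lift of g in the stabilizer factors as an element of C times a translation, so its C-factor
     also lies over g. *)
  move=> g dg; have [k Hk] := stab_lift vp dg.
  have [[a l] [b [Ca [_ b1] E]]] := CS _ Hk.
  by exists l; move: E => [/= -> _]; rewrite b1 mulmx1.
Qed.

End Quotient.
End CharTwo.

Theorem theorem4p1 (F : fieldType)
  (char2 : (2%:R : F) = 0)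
  (big : exists a : F, a != 0 /\ a != 1)
  (c : F) (c_neq0 : c != 0)                       (* chi = c * det *)
  (w x y z : 'rV[F]_4) (hU : chi4 c w x y z = 1)  (* U is defined from w,x,y,z *)
  (x0 : 'M[F]_4 * NQ (Urep w x y z)) (hx0 : isLV x0) :
  nonsplit_ext_SL4_by_F6 (stabComp c x0).
Proof. by have [a [a0 a1]] := big; apply: stab_nonsplit_ext a0 a1 hx0. Qed.
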